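(* Fix a real $\varepsilon > 0$ and an integer $r \ge 2$. For any sufficiently large $Q \ge 1$, for all but at most $Q^{1-2r\varepsilon + o(1)}$ integers $q \in [Q,2Q]$, the following holds: for every interval $\mathcal{J} = \{L+1, \ldots, L+N\} \subseteq [1,q-1]$ of $N$ consecutive integers and every sequence of complex weights $\mathcal{W} = \{\omega_\chi\}_{\chi \in \Omega_q^*}$, the sum $$ \mathcal{T}_q(\mathcal{W};\mathcal{J}) = \sum_{\chi \in \Omega_q^*} \sum_{n \in \mathcal{J}} \omega_\chi\, \mathcal{G}_q(\chi,n) $$ satisfies $$ \mathcal{T}_q(\mathcal{W};\mathcal{J}) \ll \|\mathcal{W}\|_1^{1-1/r} \|\mathcal{W}\|_2^{1/r} \left(q + N^{1/2} q^{1/2+1/(2r)}\right) q^{\varepsilon + o(1)}. $$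
   Context: $\mathbb{Z}_q^*$ is the group of units of the residue ring $\mathbb{Z}_q$ modulo $q$, and $\Omega_q^*$ is the set of primitive Dirichlet characters modulo $q$. For a Dirichlet character $\chi$ modulo $q$ and an integer $n$, the Gauss sum is $$ \mathcal{G}_q(\chi,n) = \sum_{x \in \mathbb{Z}_q^*} \chi(x)\, \mathbf{e}_q(nx), \qquad \mathbf{e}_q(z) = \exp(2\pi i z/q). $$ For $\sigma>0$, $\|\mathcal{W}\|_\sigma = \left(\sum_{\chi \in \Omega_q^*} |\omega_\chi|^\sigma\right)^{1/\sigma}$. $A \ll B$ means $|A| \le cB$ with a constant $c>0$, which here may depend on $\varepsilon$ and $r$. The $o(1)$ notation means: for every $\delta>0$ there are $Q_0$ and $C$ depending only on $\varepsilon, r, \delta$ such that for all $Q \ge Q_0$ the number of exceptional $q \in [Q,2Q]$ is at most $Q^{1-2r\varepsilon+\delta}$, and for each non-exceptional $q$ the bound holds with implied constant $C$ and with $q^{\varepsilon+o(1)}$ replaced by $q^{\varepsilon+\delta}$, uniformly in $\mathcal{J}$ and $\mathcal{W}$. *)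

(* Defs.v *)
From HB Require Import structures.
From mathcomp Require Import all_boot all_order all_algebra cyclic.
From mathcomp Require Import all_classical all_reals all_analysis.
From mathcomp Require Import complex.

Set Implicit Arguments.
Unset Strict Implicit.
Unset Printing Implicit Defensive.

Import Order.TTheory GRing.Theory Num.Theory.

Local Open Scope classical_set_scope.
Local Open Scope ring_scope.
Local Open Scope complex_scope.

Section GaussSums.
Context {R : realType}.
Implicit Types (q d n : nat) (chi psi : int -> R[i]).

Definition eq_exp q (z : int) : R[i] :=
  let t : R := 2 * pi * z%:~R / q%:R in cos t +i* sin t.

(* The value chi 1 = 1 follows from the last two clauses. *)
Definition dirichlet_character q chi : Prop :=
  [/\ forall m n : int, (m = n %[mod q%:Z])%Z -> chi m = chi n,
      forall m n : int, chi (m * n) = chi m * chi n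
    & forall n : int, (chi n != 0) = coprimez n q%:Z].

Definition induced_from q chi d : Prop :=
  exists2 psi, dirichlet_character d psi
    & forall n : int, coprimez n q%:Z -> chi n = psi n.

Definition primitive_characters q : set (int -> R[i]) :=
  [set chi | dirichlet_character q chi /\
     forall d : nat, (d %| q)%N -> (d < q)%N -> ~ induced_from q chi d].

Definition gauss_sum q chi (n : int) : R[i] :=
  \sum_(x < q | coprime x q) chi x%:Z * eq_exp q (n * x%:Z).

Definition weight_norm q (omega : (int -> R[i]) -> R[i]) (sigma : R) : R :=
  (\sum_(chi \in primitive_characters q) Normc.normc (omega chi) `^ sigma)
    `^ (sigma^-1).

Definition weighted_sum q (omega : (int -> R[i]) -> R[i]) (L N : nat) : R[i] :=
  \sum_(chi \in primitive_characters q)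
    \sum_(L.+1 <= n < (L + N).+1) omega chi * gauss_sum q chi n%:Z.

(* A sum over an infinite support would be 0 by convention; this shows that
   the two sums above are genuine finite sums. *)
Lemma finite_primitive_characters q : (0 < q)%N ->
  finite_set (primitive_characters q).
Proof.
move=> q0.
have [s sE] := closed_field_poly_normal ('X^(totient q) - 1 : {poly R[i]}).
have mem chi : dirichlet_character q chi -> forall m : int, chi m \in 0 :: s.
  move=> [per mul supp] m; rewrite inE.
  have [//|chi0 /=] := eqVneq (chi m) 0.
  have chi1 : chi 1 = 1.
    by apply: (mulfI chi0); rewrite -mul !mulr1.
  have chiX (k : nat) (j : int) : chi (j ^+ k) = chi j ^+ k.
    by elim: k => [|k IH]; rewrite ?expr0 ?chi1 // !exprS mul IH.
  have : root ('X^(totient q) - 1 : {poly R[i]}) (chi m).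
    rewrite rootE !hornerE subr_eq0 -chiX.
    have qz : q%:Z != 0 by rewrite -lt0n.
    have [r mr] : exists r : nat, (m %% q%:Z)%Z = r%:Z.
      by exists `|(m %% q%:Z)%Z|%N; rewrite gez0_abs // modz_ge0.
    have cop : coprime r q.
      by have := supp m; rewrite chi0 => /esym; rewrite /coprimez -gcdz_modl mr.
    rewrite -[X in _ == X]chi1 (per _ 1) //.
    rewrite -modzXm mr -rmorphXn /= natrXE !modz_nat.
    by rewrite (Euler_exp_totient cop).
  rewrite sE rootZ ?root_prod_XsubC //.
  rewrite lead_coef_eq0; apply/eqP => /(congr1 (fun p : {poly R[i]} => size p)).
  by rewrite size_XnsubC ?size_poly0 // totient_gt0.
pose F (f : {ffun 'I_q -> seq_sub (0 :: s)}) (m : int) : R[i] :=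
  if insub `|(m %% q%:Z)%Z|%N is Some i then ssval (f i) else 0.
apply: (@sub_finite_set _ _ (range F)); last first.
  by apply: finite_image; exact: finite_finset.
move=> chi [dchi _]; have [per _ _] := dchi.
exists [ffun i : 'I_q => SeqSub (mem _ dchi (i : nat)%:Z)] => //.
apply/funext => m; rewrite /F.
have qz : q%:Z != 0 by rewrite -lt0n.
case: insubP => [i _ iE | ].
  rewrite ffunE /=; apply: per; rewrite iE gez0_abs ?modz_ge0 //.
  by rewrite modz_mod.
by rewrite -ltz_nat gez0_abs ?modz_ge0 // ltz_pmod.
Qed.

End GaussSums.

(* Main.v *)
(* Exchanging the sums over n and x, the sum over n of G_q(chi, n) is
   \sum_x chi(x) c_x with c_x = \sum_n e_q(n x), and |c_x| <= min(N, q / |x|) for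
   |x| <= q / 2. Splitting by the sign of x and applying Hoelder's inequality
   reduces the claim to bounding \sum_chi |\sum_u chi(u) c_u|^(2r). By Bessel's
   inequality for the orthogonal characters modulo q, this moment is at most q
   times the sum of products of |c_u| over the solutions of
     u_1 ... u_r = v_1 ... v_r modulo q.
   The solutions with equality in the integers contribute (N q)^r q^o(1), since
   min(N, q/u)^2 <= N q / u and by the divisor bound. The other solutions
   contribute at most q^(2r) times a weighted count that depends on q only, and
   the average of this count over q is small, because every nonzero integer has
   few divisors q; Markov's inequality then yields the exceptional set. Neither
   primitivity of the characters nor the evaluation of Gauss sums enters. *)
Require Import Defs.
From HB Require Import structures.
From mathcomp Require Import all_boot all_order all_algebra cyclic.
From mathcomp Require Import finmap all_classical all_reals all_analysis.
From mathcomp Require Import complex.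
From mathcomp Require Import zify ring lra.

Set Implicit Arguments.
Unset Strict Implicit.
Unset Printing Implicit Defensive.

Import Order.TTheory GRing.Theory Num.Theory.

Local Open Scope ring_scope.

(** * Divisor and harmonic sum bounds *)

(** [divisors] folds over the prime decomposition; for a pair (p, e) each of the e merges lengthens
    the list by its original length, a factor e + 1 in total. *)
Lemma size_divisors n :
  size (divisors n) = (\prod_(f <- prime_decomp n) f.2.+1)%N.
Proof.
rewrite /divisors; elim: (prime_decomp n) => [|[p e] s IH]; first by rewrite big_nil.
rewrite big_cons -{}IH /=; set t := foldr _ _ _.
elim: e => [|e IH] /=; first by rewrite mul1n.
by rewrite size_merge size_cat size_map IH addnC -mulSn.
Qed.

(** With b = [a %/ k], the base satisfies a + 1 <= k (b + 1) <= k 2^b, and k b <= a. *)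
Lemma expn_succ_le k a : (0 < k)%N -> (a.+1 ^ k <= k ^ k * 2 ^ a)%N.
Proof.
move=> k0; apply: (@leq_trans ((k * 2 ^ (a %/ k)) ^ k)).
  rewrite leq_exp2r //; apply: (@leq_trans (k * (a %/ k).+1)).
    by rewrite mulnC ltn_ceil.
  by rewrite leq_mul2l ltn_expl // orbT.
by rewrite expnMn leq_mul2l -expnM leq_pexp2l ?orbT // leq_trunc_div.
Qed.

(* Multiplicativity: a prime power p^e with p >= 2^k contributes
   (e + 1)^k <= 2^(k e) <= p^e, and each of the at most 2^k smaller primes
   costs a factor k^k. *)
Lemma size_divisors_expn_le k n : (0 < k)%N -> (0 < n)%N ->
  (size (divisors n) ^ k <= (k ^ k) ^ (2 ^ k) * n)%N.
Proof.
move=> k0 n0; rewrite size_divisors.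
rewrite [X in (_ <= _ * X)%N](prod_prime_decomp n0).
rewrite (big_morph (fun m => m ^ k)%N (fun x y => expnMn x y k) (exp1n k)).
have K0 : (0 < k ^ k)%N by rewrite expn_gt0 k0.
pose w (p : nat) := if (p < 2 ^ k)%N then (k ^ k)%N else 1%N.
apply: (@leq_trans (\prod_(f <- prime_decomp n) (w f.1 * f.1 ^ f.2))%N).
  rewrite big_seq [leqRHS]big_seq; apply: leq_prod => -[p e] /=.
  move=> /mem_prime_decomp[pp e0 _]; rewrite /w.
  case: ltnP => hp.
    apply: (leq_trans (expn_succ_le e k0)).
    by rewrite leq_mul2l leq_exp2r // prime_gt1 ?orbT.
  rewrite mul1n; apply: (@leq_trans ((2 ^ k) ^ e)).
    by rewrite -expnM mulnC expnM leq_exp2r // ltn_expl.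
  by rewrite leq_exp2r.
rewrite big_split /= leq_mul2r; apply/orP; right.
rewrite -(big_map fst predT w) -/(unzip1 _).
have u : uniq (primes n) by rewrite primes_uniq.
rewrite -/(primes n) (bigID (fun p => p < 2 ^ k)%N) /=.
rewrite [X in (_ * X)%N]big1 ?muln1; last by move=> p; rewrite /w => /negbTE ->.
rewrite (eq_bigr (fun=> k ^ k)%N); last by move=> p; rewrite /w => ->.
rewrite big_const_seq iter_muln_1 leq_pexp2l //.
rewrite -size_filter -[leqRHS](size_iota 0); apply: uniq_leq_size.
  exact: filter_uniq.
by move=> p; rewrite mem_filter mem_iota add0n => /andP[].
Qed.

Section RealBounds.
Context {R : realType}.
Implicit Types eta : R.

(** Take the k-th root of [size_divisors_expn_le] for an integer k >= 1 / eta. *)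
Lemma size_divisors_le eta : 0 < eta -> exists2 C : R, 0 < C &
  forall n, (0 < n)%N -> (size (divisors n))%:R <= C * n%:R `^ eta.
Proof.
move=> eta0; pose k := (Num.truncn eta^-1).+1.
have k0 : (0 : R) < k%:R by rewrite ltr0n.
have hk : k%:R^-1 <= eta.
  by rewrite -[leRHS]invrK lef_pV2 ?posrE ?invr_gt0 // ltW // truncnS_gt.
pose K : R := ((k ^ k) ^ (2 ^ k))%:R.
have K0 : 0 < K by rewrite ltr0n !expn_gt0.
exists (K `^ k%:R^-1); first exact: powR_gt0.
move=> n n0; have n1 : (1 : R) <= n%:R by rewrite ler1n.
apply: (@le_trans _ _ (K `^ k%:R^-1 * n%:R `^ k%:R^-1)); last first.
  by rewrite ler_wpM2l ?powR_ge0 // ler_powR.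
rewrite -powRM ?ler0n ?(ltW K0) //.
have -> : (size (divisors n))%:R = ((size (divisors n))%:R ^+ k : R) `^ k%:R^-1.
  by rewrite -powR_mulrn // -powRrM divff ?powRr1 // gt_eqF.
rewrite (@ge0_ler_powR _ k%:R^-1) ?nnegrE ?invr_ge0 ?exprn_ge0 ?mulr_ge0 ?(ltW K0) //.
by rewrite -natrX -natrM ler_nat size_divisors_expn_le.
Qed.

Lemma harmonic_sum_le eta : 0 < eta -> exists2 C : R, 0 < C &
  forall M, (0 < M)%N -> \sum_(u < M) u%:R^-1 <= C * M%:R `^ eta.
Proof.
move=> eta0; exists (1 + eta^-1) => [|M M0].
  by rewrite addr_gt0 ?invr_gt0.
have step N : (0 < N)%N -> \sum_(u < N.+1) u%:R^-1 <= 1 + ln (N%:R : R).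
  elim: N => // -[|N] IH _.
    by rewrite !big_ord_recr big_ord0 /= ln1 invr0 invr1 !add0r addr0.
  rewrite big_ord_recr /= (le_trans (lerD (IH isT) (lexx _))) // -addrA lerD2l.
  have h0 : (0 : R) < N.+1%:R by rewrite ltr0n.
  have h1 : (0 : R) < N.+2%:R by rewrite ltr0n.
  (* For m = N + 2, ln (1 - 1/m) <= -1/m gives 1/m <= ln m - ln (m - 1), so the harmonic sum
     telescopes against the logarithm. *)
  have := @le_ln1Dx R (- N.+2%:R^-1).
  have -> : 1 + - N.+2%:R^-1 = N.+1%:R / N.+2%:R :> R.
    have -> : N.+1%:R = N.+2%:R - 1 :> R by rewrite -[N.+2]addn1 natrD addrK.
    by rewrite mulrBl divff ?mul1r // lt0r_neq0.
  rewrite ltrN2 invf_lt1 // ltr1n => /(_ isT).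
  rewrite ln_div ?posrE //.
  by move: (ln _) (ln _) (_^-1) => x y z; lra.
have {}step : \sum_(u < M) u%:R^-1 <= 1 + ln (M%:R : R).
  by case: M M0 => // M _; apply: le_trans (step M.+1 isT); rewrite [leRHS]big_ord_recr /= lerDl invr_ge0.
rewrite (le_trans step) // mulrDl mul1r lerD //.
  by rewrite -[leLHS](powRr0 M%:R) ler_powR ?ler1n // ltW.
(* Here eta ln M = ln (M^eta) < M^eta, which accounts for 1/eta in the constant. *)
have := @ln_sublinear R (M%:R `^ eta); rewrite powR_gt0 ?ltr0n //.
rewrite ln_powR => /(_ isT) /ltW h; rewrite mulrC ler_pdivlMr //.
by rewrite mulrC.
Qed.

End RealBounds.

(** * Dirichlet characters *)

Section Bessel.
Variables (C : numClosedFieldType) (I J : finType).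

(* Expand 0 <= \sum_x |M a_x - \sum_j (e_j x)^* V_j|^2 with V_j = \sum_x e_j x * a_x. *)
Lemma bessel_inequality (e : J -> I -> C) (M : C) (a : I -> C) : 0 < M ->
  (forall j k, \sum_x e j x * (e k x)^* = M *+ (j == k)) ->
  \sum_j `|\sum_x e j x * a x| ^+ 2 <= M * \sum_x `|a x| ^+ 2.
Proof.
move=> M0 orth; pose V j := \sum_x e j x * a x.
pose B x := \sum_j (e j x)^* * V j.
set S := \sum_j _; set A := \sum_x _.
have MR : M^* = M by apply: conj_Creal; rewrite ger0_real // ltW.
have SR : S^* = S.
  by apply: conj_Creal; rewrite ger0_real // sumr_ge0 // => j _; rewrite exprn_ge0.
(* Both cross terms and the square of [B] equal [M * S]; orthogonality enters only in [E3]. *)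
have E1 : \sum_x M * a x * (B x)^* = M * S.
  rewrite /S mulr_sumr; under eq_bigr => x _.
    rewrite rmorph_sum mulr_sumr; under eq_bigr => j _ do rewrite rmorphM /= conjCK.
    over.
  rewrite exchange_big; apply: eq_bigr => j _ /=.
  rewrite normCK -/(V j) {2}/V mulr_suml mulr_sumr; apply: eq_bigr => x _; ring.
have E2 : \sum_x B x * (M * a x)^* = M * S.
  rewrite -[RHS]conjCK rmorphM /= MR SR -E1 rmorph_sum; apply: eq_bigr => x _.
  by rewrite !rmorphM /= conjCK mulrC.
have E3 : \sum_x B x * (B x)^* = M * S.
  under eq_bigr => x _.
    rewrite {1}/B mulr_suml; under eq_bigr => j _.
      rewrite rmorph_sum mulr_sumr; under eq_bigr => k _ do rewrite rmorphM /= conjCK.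
      over.
    over.
  rewrite exchange_big /= /S mulr_sumr; apply: eq_bigr => j _.
  rewrite exchange_big /= (bigD1 j) //= [X in _ + X]big1 ?addr0 => [|k kj].
    transitivity (V j * (V j)^* * \sum_x e j x * (e j x)^*).
      by rewrite mulr_sumr; apply: eq_bigr => x _; ring.
    by rewrite orth eqxx mulr1n normCK mulrC.
  transitivity (V j * (V k)^* * \sum_x e k x * (e j x)^*).
    by rewrite mulr_sumr; apply: eq_bigr => x _; ring.
  by rewrite orth (negbTE kj) mulr0.
have : 0 <= \sum_x `|M * a x - B x| ^+ 2.
  by apply: sumr_ge0 => x _; rewrite exprn_ge0.
have -> : \sum_x `|M * a x - B x| ^+ 2 = M * (M * A) - M * S.
  transitivity (\sum_x M * a x * (M * a x)^* - \sum_x M * a x * (B x)^*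
     - \sum_x B x * (M * a x)^* + \sum_x B x * (B x)^*).
    rewrite -!sumrN -!big_split /=; apply: eq_bigr => x _.
    by rewrite normCK rmorphB /=; ring.
  rewrite E1 E2 E3 subrK; congr (_ - _).
  rewrite /A !mulr_sumr; apply: eq_bigr => x _.
  by rewrite normCK rmorphM /= MR; ring.
by rewrite -mulrBr pmulr_rge0 // subr_ge0.
Qed.

End Bessel.

Section Characters.
Context {R : realType}.
Implicit Types (q : nat) (chi psi : int -> R[i]).
Local Notation normc := (@Normc.normc R).

Lemma normc_normr (z : R[i]) : (normc z)%:C%C = `|z|.
Proof. by case: z. Qed.

Lemma normc_ge0 (z : R[i]) : 0 <= normc z.
Proof. by case: z => a b; rewrite sqrtr_ge0. Qed.

Lemma normc_sum (I : Type) (s : seq I) (P : pred I) (F : I -> R[i]) :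
  normc (\sum_(i <- s | P i) F i) <= \sum_(i <- s | P i) normc (F i).
Proof.
rewrite -lecR normc_normr rmorph_sum; apply: le_trans (ler_norm_sum _ _ _) _.
by apply: ler_sum => i _; rewrite -normc_normr.
Qed.

Lemma normc_prod (I : Type) (s : seq I) (P : pred I) (F : I -> R[i]) :
  normc (\prod_(i <- s | P i) F i) = \prod_(i <- s | P i) normc (F i).
Proof. exact: (big_morph normc (@Normc.normcM R) (Normc.normc1 R)). Qed.

Lemma normcX (z : R[i]) n : normc (z ^+ n) = normc z ^+ n.
Proof. by elim: n => [|n IH]; rewrite ?expr0 ?Normc.normc1 // !exprS Normc.normcM IH. Qed.

Lemma dirichlet_character1 q chi : dirichlet_character q chi -> chi 1 = 1.
Proof.
move=> [_ mul supp]; have chi0 : chi 1 != 0 by rewrite supp /coprimez gcd1z.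
by apply: (mulfI chi0); rewrite -mul !mulr1.
Qed.

Lemma dirichlet_character_prod q chi (I : Type) (s : seq I) (F : I -> nat) :
  dirichlet_character q chi ->
  chi (\prod_(i <- s) F i)%N%:Z = \prod_(i <- s) chi (F i)%:Z.
Proof.
move=> dchi; apply: (big_morph (fun n : nat => chi n%:Z)) => [m n|].
  by rewrite PoszM; case: dchi.
exact: dirichlet_character1 dchi.
Qed.

Lemma dirichlet_character_mod q chi (n : nat) : dirichlet_character q chi ->
  chi (n %% q)%N%:Z = chi n%:Z.
Proof. by case=> per _ _; apply: per; rewrite -modz_nat modz_mod. Qed.

(** By Euler's theorem the value is a root of unity of order dividing [totient q]. *)
Lemma normc_dirichlet_character q chi (m : int) : (0 < q)%N ->
  dirichlet_character q chi -> coprimez m q%:Z -> normc (chi m) = 1.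
Proof.
move=> q0 dchi cop; have [per mul supp] := dchi.
have chiX (k : nat) (j : int) : chi (j ^+ k) = chi j ^+ k.
  elim: k => [|k IH]; first by rewrite !expr0 (dirichlet_character1 dchi).
  by rewrite !exprS mul IH.
have qz : q%:Z != 0 by rewrite -lt0n.
have [n mn] : exists n : nat, (m %% q%:Z)%Z = n%:Z.
  by exists `|(m %% q%:Z)%Z|%N; rewrite gez0_abs // modz_ge0.
have copn : coprime n q by move: cop; rewrite /coprimez -gcdz_modl mn.
have : chi m ^+ totient q = 1.
  rewrite -chiX -(dirichlet_character1 dchi); apply: per.
  by rewrite -modzXm mn -rmorphXn /= natrXE !modz_nat (Euler_exp_totient copn).
move=> /(congr1 normc)/eqP; rewrite normcX Normc.normc1.
by rewrite pexpr_eq1 ?totient_gt0 ?normc_ge0 // => /eqP.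
Qed.

(** Multiplication by a unit permutes the residues: q dividing t (x - y) forces x = y when 0 <= x -
    y < q. *)
Lemma sum_mod_mul (V : nmodType) q (t : nat) (F : nat -> V) : (0 < q)%N -> coprime t q ->
  \sum_(x < q) F ((t * x) %% q)%N = \sum_(x < q) F x.
Proof.
move=> q0 cop; pose h (x : 'I_q) := Ordinal (ltn_pmod (t * x) q0).
rewrite [RHS](@reindex_inj _ _ _ _ h) // => x y /(congr1 val) /= /eqP.
wlog le_yx : x y / (y <= x)%N => [wl E|].
  by case: (leqP y x) => [|/ltnW] le; [|symmetry]; apply: wl; rewrite // eq_sym.
rewrite eqn_mod_dvd ?leq_mul2l ?le_yx ?orbT // -mulnBr Gauss_dvdr ?[coprime q t]coprime_sym //.
move=> dv; apply/val_inj/eqP; rewrite eqn_leq le_yx andbT -subn_eq0.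
apply: contraTT dv; rewrite -lt0n => sub0; apply/negP => /(dvdn_leq sub0).
by rewrite leqNgt (leq_ltn_trans (leq_subr _ _) (ltn_ord x)).
Qed.

(** Substituting t x for x, with t a unit, shows chi(t) S = psi(t) S for the sum S. If S is nonzero,
    the characters agree on units, hence everywhere, since both vanish elsewhere. *)
Lemma dirichlet_character_orthogonal q chi psi : (0 < q)%N ->
  dirichlet_character q chi -> dirichlet_character q psi -> chi <> psi ->
  \sum_(x < q) chi x%:Z * (psi x%:Z)^* = 0.
Proof.
move=> q0 dchi dpsi neq; apply/eqP/negPn/negP => S0; apply: neq.
have E (t : nat) : coprime t q -> chi t%:Z = psi t%:Z.
  move=> cop; apply: (mulIf S0).
  have -> : psi t%:Z * \sum_(x < q) chi x%:Z * (psi x%:Z)^* =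
     psi t%:Z * \sum_(x < q) chi ((t * x) %% q)%N%:Z * (psi ((t * x) %% q)%N%:Z)^*.
    congr (_ * _).
    by rewrite (@sum_mod_mul _ _ _ (fun x => chi x%:Z * (psi x%:Z)^*)).
  rewrite !mulr_sumr; apply: eq_bigr => x _.
  rewrite !(dirichlet_character_mod _ dchi, dirichlet_character_mod _ dpsi).
  rewrite !PoszM; case: (dchi) => _ -> _; case: (dpsi) => _ -> _.
  have pt : psi t * (psi t)^* = 1.
    by rewrite -normCK -normc_normr (normc_dirichlet_character q0 dpsi) // expr1n.
  by rewrite -[LHS]mulr1 -pt rmorphM /=; ring.
apply/funext => m; have qz : q%:Z != 0 by rewrite -lt0n.
have [n mn] : exists n : nat, (m %% q%:Z)%Z = n%:Z.
  by exists `|(m %% q%:Z)%Z|%N; rewrite gez0_abs // modz_ge0.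
have cong : (m = n%:Z %[mod q%:Z])%Z by rewrite -mn modz_mod.
have [perc _ supc] := dchi; have [perp _ supp] := dpsi.
rewrite (perc _ _ cong) (perp _ _ cong).
have [cop|ncop] := boolP (coprime n q); first exact: E.
have -> : chi n = 0 by apply/eqP/negPn; rewrite supc.
by symmetry; apply/eqP/negPn; rewrite supp.
Qed.

Lemma dirichlet_character_norm q chi : (0 < q)%N -> dirichlet_character q chi ->
  \sum_(x < q) chi x%:Z * (chi x%:Z)^* = (totient q)%:R.
Proof.
move=> q0 dchi; rewrite totient_count_coprime big_mkord natr_sum.
apply: eq_bigr => x _; rewrite -normCK -normc_normr.
have [cop|ncop] := boolP (coprime x q).
  by rewrite (normc_dirichlet_character q0 dchi) // expr1n coprime_sym cop.
have -> : chi x = 0 by apply/eqP/negPn; case: dchi => _ _ ->.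
by rewrite Normc.normc0 expr0n coprime_sym (negbTE ncop).
Qed.

(** Bessel's inequality with constant [totient q], which is then relaxed to q. *)
Lemma bessel_dirichlet q (S : {fset (int -> R[i])}) (a : 'I_q -> R[i]) : (0 < q)%N ->
  {in S, forall chi, dirichlet_character q chi} ->
  \sum_(chi <- S) normc (\sum_(x < q) chi x%:Z * a x) ^+ 2 <=
    q%:R * \sum_(x < q) normc (a x) ^+ 2.
Proof.
move=> q0 dS; apply: (@le_trans _ _ ((totient q)%:R * \sum_(x < q) normc (a x) ^+ 2)).
  rewrite -lecR rmorphM !rmorph_sum rmorph_nat /=.
  rewrite big_seq_fsetE /=.
  under eq_bigr => chi _ do rewrite rmorphXn /= normc_normr.
  under [in leRHS]eq_bigr => x _ do rewrite rmorphXn /= normc_normr.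
  apply: (@bessel_inequality _ _ _ (fun (chi : S) (x : 'I_q) => val chi x%:Z)).
    by rewrite ltr0n totient_gt0.
  move=> chi psi; have [->|neq] := eqVneq chi psi.
    by rewrite mulr1n; apply: dirichlet_character_norm => //; exact: dS (valP psi).
  rewrite mulr0n; apply: dirichlet_character_orthogonal => //.
  - exact: dS (valP chi).
  - exact: dS (valP psi).
  - by move=> /val_inj E; rewrite E eqxx in neq.
apply: ler_wpM2r; first by apply: sumr_ge0 => x _; rewrite exprn_ge0 // normc_ge0.
rewrite ler_nat totient_count_coprime big_mkord.
by rewrite -[leqRHS](card_ord q) -sum1_card; apply: leq_sum => x _; exact: leq_b1.
Qed.
End Characters.

(** * Exponential sums *)

Section GaussCoefficients.
Context {R : realType}.
Implicit Types (q L N u : nat).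
Local Notation normc := (@Normc.normc R).
Local Notation eq_exp := (@eq_exp R).

Lemma eq_expD q (z w : int) : eq_exp q (z + w) = eq_exp q z * eq_exp q w.
Proof.
rewrite /eq_exp; set a := 2 * pi * z%:~R / q%:R; set b := 2 * pi * w%:~R / q%:R.
have -> : 2 * pi * (z + w)%:~R / q%:R = a + b by rewrite /a /b intrD; ring.
by rewrite cosD sinD; apply/eqP; rewrite eq_complex /=; apply/andP; split; apply/eqP; ring.
Qed.

Lemma eq_exp0 q : eq_exp q 0 = 1.
Proof. by rewrite /eq_exp mulr0 mul0r cos0 sin0. Qed.

Lemma eq_exp_natM q (n : nat) (z : int) : eq_exp q (n%:Z * z) = eq_exp q z ^+ n.
Proof.
elim: n => [|n IH]; first by rewrite mul0r eq_exp0.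
by rewrite exprS -IH -eq_expD; congr eq_exp; lia.
Qed.

Lemma normc_eq_exp q z : normc (eq_exp q z) = 1.
Proof. by rewrite /= cos2Dsin2 sqrtr1. Qed.

Lemma eq_expq q : (0 < q)%N -> eq_exp q q%:Z = 1.
Proof.
move=> q0; rewrite /eq_exp -mulrA divff ?pnatr_eq0 -?lt0n // mulr1 mulr_natl.
by rewrite cos2pi sin2pi.
Qed.

Lemma eq_expN q z : eq_exp q (- z) = (eq_exp q z)^*%C.
Proof.
by rewrite /eq_exp mulrNz mulrN mulNr cosN sinN.
Qed.

(** The coefficient of chi(z) in the sum of the Gauss sums over n, once the two summations are
    exchanged. *)
Definition exp_sum q L N (z : int) : R[i] :=
  \sum_(L.+1 <= n < (L + N).+1) eq_exp q (n%:Z * z).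

Lemma normc_exp_sum_le q L N z : normc (exp_sum q L N z) <= N%:R.
Proof.
apply: le_trans (normc_sum _ _ _) _.
under eq_bigr => n _ do rewrite normc_eq_exp.
by rewrite sumr_const_nat subSS addKn.
Qed.

(** Multiplying by 1 - [eq_exp q z] makes the geometric sum telescope to two terms of modulus 1. The
    product form avoids dividing by a possibly vanishing factor. *)
Lemma exp_sum_geometric q L N z :
  normc (exp_sum q L N z) * normc (1 - eq_exp q z) <= 2.
Proof.
rewrite -Normc.normcM /exp_sum mulr_suml.
under eq_bigr => n _ do rewrite eq_exp_natM mulrBr mulr1 -exprSr.
rewrite (telescope_sumr_eq (fun n => - eq_exp q z ^+ n)) ?ltnS ?leq_addr //; last first.
  by move=> n _; rewrite opprK addrC.
apply: le_trans (le_normcD _ _) _.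
by rewrite opprK [normc (- _)]normcN !normcX !normc_eq_exp !expr1n.
Qed.

(* With m = q %/ (2u), the point eq_exp q (m u) lies in the left half plane, so
   that 1 <= |1 - z^m| <= m |1 - z| for z = eq_exp q u. *)
Lemma normc_1Beq_exp_ge q u : (0 < u)%N -> (2 * u <= q)%N ->
  (2 * u)%:R <= q%:R * normc (1 - eq_exp q u%:Z).
Proof.
move=> u0 uq; have q0 : (0 < q)%N by apply: leq_trans uq; rewrite muln_gt0.
pose m := (q %/ (2 * u))%N; set z := eq_exp q u%:Z.
have qR : 0 < q%:R :> R by rewrite ltr0n.
have m1 : (m * (2 * u) <= q)%N by exact: leq_trunc_div.
have m2 : (q < m.+1 * (2 * u))%N by rewrite ltn_ceil // muln_gt0.
have m0 : (0 < m)%N by rewrite divn_gt0 ?muln_gt0.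
(* Because m + 1 <= 2 m. With [m1] this places the angle 2 pi m u / q in [pi / 2, pi]. *)
have m3 : (q <= 4 * (m * u))%N by nia.
have zm : 1 <= normc (1 - z ^+ m).
  rewrite -eq_exp_natM; set t := 2 * pi * (m%:Z * u%:Z)%:~R / q%:R : R.
  have tE : t = 2 * pi * (m * u)%:R / q%:R by rewrite /t -PoszM.
  have pi0 := pi_gt0 R.
  have cost : cos t <= 0.
    rewrite -[t](subrK pi) cosDpi oppr_le0 cos_ge0_pihalf //.
    have h1 : t <= pi.
      rewrite tE ler_pdivrMr // [2 * pi]mulrC -mulrA ler_wpM2l ?(ltW pi0) //.
      by rewrite -natrM ler_nat; lia.
    have h2 : pi / 2 <= t.
      rewrite tE ler_pdivlMr // mulrAC ler_pdivrMr //.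
      rewrite [X in _ <= X](_ : _ = pi * (4 * (m * u))%:R); last by rewrite !natrM; ring.
      by rewrite ler_wpM2l ?(ltW pi0) // ler_nat.
    by apply/andP; split; lra.
  rewrite /Normc.normc /eq_exp -/t /= -[leLHS]sqrtr1 ler_wsqrtr //.
  by have := sqr_ge0 (- sin t); nra.
have : normc (1 - z ^+ m) <= m%:R * normc (1 - z).
  rewrite -[X in normc X]opprB -[X in _ * normc X]opprB !normcN subrX1 Normc.normcM mulrC.
  apply: ler_wpM2r; first exact: normc_ge0.
  apply: le_trans (normc_sum _ _ _) _.
  under eq_bigr => i _ do rewrite normcX normc_eq_exp expr1n.
  by rewrite sumr_const card_ord.
move=> /(le_trans zm) h; have D0 := normc_ge0 (1 - z).
apply: (@le_trans _ _ ((m * (2 * u))%:R * normc (1 - z))).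
  by rewrite [(m * _)%:R]natrM mulrAC ler_peMl ?ler0n.
by rewrite ler_wpM2r // ler_nat.
Qed.

(** Divide the geometric bound 2 by the lower bound 2 u / q for |1 - z|. Passing to -u conjugates z
    and keeps |1 - z|. *)
Lemma normc_exp_sum_le_div q L N u : (0 < u)%N -> (2 * u <= q)%N ->
  normc (exp_sum q L N u%:Z) <= q%:R * u%:R^-1 /\
  normc (exp_sum q L N (- u%:Z)) <= q%:R * u%:R^-1.
Proof.
move=> u0 uq; have uR : (0 : R) < u%:R by rewrite ltr0n.
have low := normc_1Beq_exp_ge u0 uq.
have conj1 : normc (1 - eq_exp q (- u%:Z)) = normc (1 - eq_exp q u%:Z).
  rewrite eq_expN; case: (eq_exp q u) => a b.
  by rewrite /= !sub0r opprK sqrrN.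
have gen z : normc (1 - eq_exp q z) = normc (1 - eq_exp q u%:Z) ->
    normc (exp_sum q L N z) <= q%:R * u%:R^-1.
  move=> E; rewrite ler_pdivlMr //; have := exp_sum_geometric q L N z; rewrite E => h.
  rewrite -(ler_pM2l (ltr0n R 2)) mulrCA -natrM.
  apply: le_trans (ler_wpM2l (normc_ge0 _) low) _.
  by rewrite mulrCA [leRHS]mulrC ler_wpM2l.
by split; apply: gen.
Qed.
End GaussCoefficients.

(** * Moments of character sums *)

Section Moment.
Context {R : realType}.
Implicit Types (q M r : nat).
Local Notation normc := (@Normc.normc R).

Definition prodn M r (f : {ffun 'I_r -> 'I_M}) : nat := \prod_i f i.

(* Terms with a zero entry drop out, because 0^-1 = 0. *)
Definition diagonal_sum M r : R :=
  \sum_(f : {ffun 'I_r -> 'I_M})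
    \sum_(g : {ffun 'I_r -> 'I_M} | prodn f == prodn g) (prodn f)%:R^-1.

(** Neither the interval nor the weights enter, so an exceptional set defined by this sum serves all
    of them at once. *)
Definition offdiagonal_sum q M r : R :=
  \sum_(f : {ffun 'I_r -> 'I_M})
    \sum_(g : {ffun 'I_r -> 'I_M} |
        (prodn f == prodn g %[mod q]) && (prodn f != prodn g))
      (prodn f)%:R^-1 * (prodn g)%:R^-1.

Lemma prodnV M r (f : {ffun 'I_r -> 'I_M}) :
  (prodn f)%:R^-1 = \prod_i (f i)%:R^-1 :> R.
Proof. by rewrite /prodn natr_prod prodfV. Qed.

Lemma sum_prodnV M r :
  \sum_(f : {ffun 'I_r -> 'I_M}) (prodn f)%:R^-1 = (\sum_(u < M) u%:R^-1) ^+ r :> R.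
Proof.
under eq_bigr => f _ do rewrite prodnV.
rewrite -(bigA_distr_bigA (fun (_ : 'I_r) (u : 'I_M) => u%:R^-1 : R)) prodr_const card_ord //.
Qed.

(** Off the diagonal every factor is bounded by q / u. On the diagonal each squared factor is
    bounded by [K] times q / u, which replaces q^(2r) by (K q)^r. *)
Lemma dirichlet_moment_le q M r (S : {fset (int -> R[i])}) (a : nat -> R[i]) (K : R) :
  (0 < q)%N -> {in S, forall chi, dirichlet_character q chi} ->
  (forall u, normc (a u) <= K) -> (forall u, normc (a u) <= q%:R * u%:R^-1) ->
  \sum_(chi <- S) normc (\sum_(u < M) chi u%:Z * a u) ^+ (2 * r) <=
  q%:R * ((K * q%:R) ^+ r * diagonal_sum M r + q%:R ^+ (2 * r) * offdiagonal_sum q M r).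
Proof.
move=> q0 dS aK aq.
pose A (f : {ffun 'I_r -> 'I_M}) := \prod_i a (f i).
pose B (f : {ffun 'I_r -> 'I_M}) := \prod_i normc (a (f i)).
pose p (f : {ffun 'I_r -> 'I_M}) := Ordinal (ltn_pmod (prodn f) q0).
have pE f g : (p f == p g) = (prodn f == prodn g %[mod q]) by [].
have K0 : 0 <= K by apply: le_trans (aK 0%N); exact: normc_ge0.
have B0 f : 0 <= B f by apply: prodr_ge0 => i _; exact: normc_ge0.
(* Expanding the r-th power and grouping the tuples by their product modulo q gives a single
   character sum over residues, to which Bessel applies. *)
have power chi : dirichlet_character q chi ->
    normc (\sum_(u < M) chi u%:Z * a u) ^+ (2 * r) =
    normc (\sum_(x < q) chi x%:Z * \sum_(f | p f == x) A f) ^+ 2.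
  move=> dchi; rewrite mulnC exprM -normcX; congr (normc _ ^+ 2).
  rewrite -[X in _ ^+ X](card_ord r) -prodr_const bigA_distr_bigA /=.
  rewrite (partition_big p predT) //=; apply: eq_bigr => x _.
  rewrite mulr_sumr; apply: eq_bigr => f /eqP <-.
  by rewrite big_split /= -(dirichlet_character_prod _ _ dchi) (dirichlet_character_mod _ dchi).
rewrite big_seq (eq_bigr _ (fun chi h => power chi (dS chi h))) -big_seq.
apply: le_trans (bessel_dirichlet _ q0 dS) _.
apply: ler_wpM2l => //.
have Bq f : B f <= q%:R ^+ r * (prodn f)%:R^-1.
  rewrite prodnV -[X in _ ^+ X](card_ord r) -prodr_const -big_split /=.
  by apply: ler_prod => i _; rewrite normc_ge0 aq.
have B2 f : B f ^+ 2 <= (K * q%:R) ^+ r * (prodn f)%:R^-1.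
  rewrite prodnV -[X in (K * _) ^+ X](card_ord r) -prodr_const -big_split /=.
  rewrite -prodrXl; apply: ler_prod => i _; rewrite exprn_ge0 ?normc_ge0 //=.
  by rewrite expr2 -mulrA ler_pM ?normc_ge0.
apply: (@le_trans _ _ (\sum_f \sum_(g | p f == p g) B f * B g)).
  rewrite [leRHS](partition_big p predT) //=; apply: ler_sum => x _.
  apply: (@le_trans _ _ ((\sum_(f | p f == x) B f) ^+ 2)).
    rewrite lerXn2r ?nnegrE ?normc_ge0 ?sumr_ge0 //.
    by apply: le_trans (normc_sum _ _ _) _; apply: ler_sum => f _; rewrite normc_prod.
  rewrite expr2 mulr_suml; apply: ler_sum => f /eqP <-.
  by rewrite mulr_sumr (eq_bigl _ _ (fun g => eq_sym (p f) (p g))).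
rewrite /diagonal_sum /offdiagonal_sum !mulr_sumr -big_split /=.
apply: ler_sum => f _; rewrite (bigID (fun g => prodn f == prodn g)) /=.
apply: lerD.
  rewrite mulr_sumr (eq_bigl (fun g => prodn f == prodn g)) => [|g].
    apply: ler_sum => g /eqP fg.
    (* [B f * B g] is at most the mean of the two squares, and these share one bound because the
       products agree. *)
    have := B2 f; have := B2 g; rewrite -fg; have := sqr_ge0 (B f - B g).
    rewrite sqrrB -mulr_natr; lra.
  by rewrite pE; case: (prodn f =P prodn g) => [->|]; rewrite ?eqxx ?andbF.
rewrite mulr_sumr; apply: ler_sum => g _.
by rewrite mulnC exprM expr2 mulrACA ler_pM.
Qed.

(** Every entry of such a tuple divides m, which leaves at most [size (divisors m)] choices for
    each. *)
Lemma card_prodn_le M r m : (0 < m)%N ->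
  (#|[pred g : {ffun 'I_r -> 'I_M} | prodn g == m]| <= size (divisors m) ^ r)%N.
Proof.
move=> m0; pose D := [pred u : 'I_M | (u %| m)%N].
have /leq_trans : (#|[pred g : {ffun 'I_r -> 'I_M} | prodn g == m]| <=
    #|@ffun_on 'I_r D|)%N.
  apply: subset_leq_card; apply/fintype.subsetP => g; rewrite inE => /eqP gm.
  by apply/ffun_onP => i; rewrite inE -gm /prodn (bigD1 i) //= dvdn_mulr.
apply; rewrite card_ffun_on card_ord; case: r => // r; rewrite leq_exp2r //.
rewrite cardE -(size_map val); apply: uniq_leq_size.
  by rewrite map_inj_uniq ?enum_uniq //; exact: val_inj.
by move=> d /mapP[u]; rewrite mem_enum inE -dvdn_divisors // => ? ->.
Qed.

Lemma prodn_le M r (f : {ffun 'I_r -> 'I_M}) : (prodn f <= M ^ r)%N.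
Proof.
rewrite -[X in (_ <= _ ^ X)%N](card_ord r) -prod_nat_const.
by apply: leq_prod => i _; exact/ltnW/ltn_ord.
Qed.

(** For fixed [f] at most D^r tuples [g] share its product; the remaining sum over [f] factors into
    harmonic sums. *)
Lemma diagonal_sum_le M r (D : R) :
  (forall m, (0 < m <= M ^ r)%N -> (size (divisors m))%:R <= D) ->
  diagonal_sum M r <= D ^+ r * (\sum_(u < M) u%:R^-1) ^+ r.
Proof.
move=> hD; rewrite -sum_prodnV mulr_sumr; apply: ler_sum => f _.
have [->|f0] := posnP (prodn f).
  by rewrite invr0 mulr0 big1.
rewrite sumr_const -[leLHS]mulr_natl ler_wpM2r ?invr_ge0 //.
apply: (@le_trans _ _ (size (divisors (prodn f)) ^ r)%:R).
  rewrite ler_nat; apply: leq_trans (card_prodn_le M r f0).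
  by apply: subset_leq_card; apply/fintype.subsetP => g; rewrite !inE eq_sym.
rewrite natrX lerXn2r ?nnegrE ?ler0n //.
  by apply: le_trans (hD (prodn f) _); rewrite ?ler0n // f0 prodn_le.
by apply: hD; rewrite f0 prodn_le.
Qed.

(** Sum over q first: for fixed [f] and [g] with distinct products, the moduli that count are
    divisors of the nonzero difference, so there are at most D of them. *)
Lemma sum_offdiagonal_sum_le (s : seq nat) M r (D : R) : uniq s -> 0 <= D ->
  (forall m, (0 < m <= M ^ r)%N -> (size (divisors m))%:R <= D) ->
  \sum_(q <- s) offdiagonal_sum q M r <= D * (\sum_(u < M) u%:R^-1) ^+ (2 * r).
Proof.
move=> us D0 hD; rewrite mul2n -addnn exprD -sum_prodnV mulr_suml mulr_sumr /offdiagonal_sum.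
rewrite exchange_big /=; apply: ler_sum => f _.
rewrite mulr_sumr mulr_sumr.
under eq_bigr => q _ do rewrite big_mkcond.
rewrite exchange_big /=; apply: ler_sum => g _.
rewrite -big_mkcond /=; set w := _ * _.
have w0 : 0 <= w by rewrite mulr_ge0 ?invr_ge0.
have [fg|fg] := eqVneq (prodn f) (prodn g).
  rewrite big_pred0 => [|q]; last by rewrite andbF.
  exact: mulr_ge0.
(* With truncated subtraction one summand is 0, so this is the absolute difference. *)
pose m := ((prodn f - prodn g) + (prodn g - prodn f))%N.
have m0 : (0 < m <= M ^ r)%N.
  by have := prodn_le f; have := prodn_le g; rewrite /m; lia.
rewrite -big_filter big_const_seq count_predT iter_addr addr0 -mulr_natl.
apply: ler_wpM2r => //; apply: le_trans (hD m m0); rewrite ler_nat.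
apply: uniq_leq_size; first exact: filter_uniq.
move=> q; rewrite mem_filter andbT => /andP[+ _].
rewrite -dvdn_divisors; last by case/andP: m0.
rewrite /m; case: (leqP (prodn f) (prodn g)) => [le|/ltnW le].
  by rewrite eq_sym eqn_mod_dvd // (eqP (_ : prodn f - prodn g == 0)%N) // subn_eq0.
by rewrite eqn_mod_dvd // (eqP (_ : prodn g - prodn f == 0)%N) ?addn0 // subn_eq0.
Qed.
End Moment.

(** * Hoelder's inequality *)

Section Holder.
Context {R : realType} {I : finType}.
Implicit Types (w U V : I -> R).

(** The graph of x^(n+1) lies above its tangent at y. The induction step multiplies by x and adds (n
    + 1) y^n (x - y)^2 >= 0. *)
Lemma young_tangent (x y : R) n : 0 <= x -> 0 <= y ->
  n.+1%:R * y ^+ n * x <= x ^+ n.+1 + n%:R * y ^+ n.+1.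
Proof.
move=> x0 y0; elim: n => [|n IH]; first by rewrite expr0 expr1; lra.
have sq : 0 <= n.+1%:R * y ^+ n * (x - y) ^+ 2.
  by apply: mulr_ge0; [rewrite mulr_ge0 ?exprn_ge0 | exact: sqr_ge0].
have := ler_wpM2r x0 IH; rewrite !exprS -[n.+2]addn1 -[n.+1]addn1 !natrD.
move: sq; rewrite -[n.+1]addn1 natrD sqrrB.
move: (y ^+ n) (x ^+ n) (n%:R : R) => Y X N; rewrite -mulr_natl expr2 expr2; lra.
Qed.

(** With A the total weight and P the weighted sum, apply the tangent inequality at x = A U_i and y
    = P, then sum against the weights. No roots are needed. *)
Lemma power_mean w U n : (forall i, 0 <= w i) -> (forall i, 0 <= U i) ->
  (\sum_i w i * U i) ^+ n.+1 <= (\sum_i w i) ^+ n * \sum_i w i * U i ^+ n.+1.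
Proof.
move=> w0 U0; set P := \sum_i w i * U i; set A := \sum_i w i; set T := \sum_i _.
have A0 : 0 <= A by apply: sumr_ge0.
have P0 : 0 <= P by apply: sumr_ge0 => i _; rewrite mulr_ge0.
have [AE|An] := eqVneq A 0.
  have wE i : w i = 0.
    by apply/eqP; move/eqP: AE; rewrite psumr_eq0 // => /allP/(_ i); apply; rewrite mem_index_enum.
  rewrite /P /T !big1 ?mulr0 ?expr0n // => i _; by rewrite wE mul0r.
have Agt : 0 < A by rewrite lt_def An.
rewrite -(ler_pM2l Agt) mulrA -exprS.
suff : n.+1%:R * P ^+ n * (A * P) <= A ^+ n.+1 * T + n%:R * P ^+ n.+1 * A.
  rewrite [P ^+ n.+1]exprS -natr1; move: (P ^+ n) (A ^+ n.+1) (n%:R : R) => x y z; lra.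
rewrite {3}/P /T {3}/A !mulr_sumr -big_split /=; apply: ler_sum => i _.
have := ler_wpM2r (w0 i) (young_tangent n (mulr_ge0 A0 (U0 i)) P0).
rewrite exprMn; move: (P ^+ n) (A ^+ n.+1) (P ^+ n.+1) (U i ^+ n.+1) => x y z t; lra.
Qed.

Lemma cauchy_schwarz w V : (forall i, 0 <= w i) -> (forall i, 0 <= V i) ->
  (\sum_i w i * V i) ^+ 2 <= (\sum_i w i ^+ 2) * \sum_i V i ^+ 2.
Proof.
move=> w0 V0.
(* The weights w^2 and values V / w recover w V as their product, also at w = 0, where the quotient
   is 0. *)
have := @power_mean (fun i => w i ^+ 2) (fun i => V i / w i) 1.
have E i : w i ^+ 2 * (V i / w i) = w i * V i.
  by have [->|wi] := eqVneq (w i) 0; [rewrite expr0n !mul0r | field].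
rewrite (eq_bigr _ (fun i _ => E i)) => /(_ _ _) h; apply: le_trans (h _ _) _.
- by move=> i; rewrite sqr_ge0.
- by move=> i; rewrite divr_ge0.
rewrite expr1 ler_wpM2l ?sumr_ge0 // => [i _|]; first exact: sqr_ge0.
apply: ler_sum => i _; have [->|wi] := eqVneq (w i) 0.
  by rewrite expr0n mul0r sqr_ge0.
by rewrite exprMn exprVn mulrCA divff ?mulr1 // expf_neq0.
Qed.

(** The power mean inequality with exponent r, followed by Cauchy-Schwarz for w and U^r. *)
Lemma holder_even_moment w U r : (0 < r)%N -> (forall i, 0 <= w i) -> (forall i, 0 <= U i) ->
  (\sum_i w i * U i) ^+ (2 * r) <=
  (\sum_i w i) ^+ (2 * r.-1) * (\sum_i w i ^+ 2) * \sum_i U i ^+ (2 * r).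
Proof.
case: r => // r _ w0 U0 /=.
have P0 : 0 <= \sum_i w i * U i by apply: sumr_ge0 => i _; rewrite mulr_ge0.
have Q0 : 0 <= \sum_i w i * U i ^+ r.+1 by apply: sumr_ge0 => i _; rewrite mulr_ge0 ?exprn_ge0.
have A0 : 0 <= \sum_i w i by apply: sumr_ge0.
rewrite mulnC exprM.
apply: (@le_trans _ _ (((\sum_i w i) ^+ r * \sum_i w i * U i ^+ r.+1) ^+ 2)).
  by rewrite lerXn2r ?nnegrE ?mulr_ge0 ?exprn_ge0 // power_mean.
rewrite exprMn -exprM mulnC -mulrA ler_wpM2l ?exprn_ge0 //.
under [X in _ <= _ * X]eq_bigr => i _ do rewrite exprM.
by apply: (@cauchy_schwarz w (fun i => U i ^+ r.+1)) => // i; rewrite exprn_ge0.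
Qed.
End Holder.

(** * Bounds for the moments and splitting of the Gauss sums *)

Section MomentBounds.
Context {R : realType}.
Local Notation normc := (@Normc.normc R).

(** Off the diagonal only the sum over moduli is controlled, so single moduli may be exceptional. *)
Lemma moment_sums_le r (delta : R) : (0 < r)%N -> 0 < delta ->
  exists2 C : R, 0 < C & forall (Q : R) M, 1 <= Q -> (0 < M)%N -> M%:R <= 3 * Q ->
    diagonal_sum M r <= C * Q `^ delta /\
    forall s, uniq s -> \sum_(q <- s) offdiagonal_sum q M r <= C * Q `^ delta.
Proof.
(* The bounds below contain r^2 + r or 3 r factors (3 Q)^eta; both numbers are at most 3 r^2. *)
move=> r0 d0; pose eta := delta / (3 * r ^ 2)%:R.
have r2 : (0 : R) < (3 * r ^ 2)%:R by rewrite ltr0n muln_gt0 expn_gt0 r0.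
have eta0 : 0 < eta by rewrite divr_gt0.
have [C1 C10 h1] := size_divisors_le eta0.
have [C2 C20 h2] := harmonic_sum_le eta0.
exists (((C1 * C2) ^+ r + C1 * C2 ^+ (2 * r)) * 3 `^ delta).
  by rewrite mulr_gt0 ?powR_gt0 // addr_gt0 ?mulr_gt0 ?exprn_gt0 ?mulr_gt0.
have rr : (r <= r * r)%N by rewrite leq_pmulr.
move=> Q M Q1 M0 MQ; pose X := (3 * Q) `^ eta.
have X1 : 1 <= X by rewrite -[leLHS](powRr0 (3 * Q)) ler_powR ?(ltW eta0) //; lra.
have X0 : 0 <= X by apply: le_trans X1.
have XE n : (n <= 3 * r ^ 2)%N -> X ^+ n <= 3 `^ delta * Q `^ delta.
  move=> le; apply: (le_trans (ler_weXn2l X1 le)).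
  rewrite -powR_mulrn // -powRrM /eta mulfVK ?lt0r_neq0 // powRM //.
  exact: le_trans Q1.
have HM : \sum_(u < M) u%:R^-1 <= C2 * X.
  apply: le_trans (h2 M M0) _; rewrite ler_wpM2l ?(ltW C20) //.
  by rewrite (@ge0_ler_powR _ eta) ?nnegrE ?(ltW eta0) ?ler0n //; lra.
have H0 : (0 : R) <= \sum_(u < M) u%:R^-1 by apply: sumr_ge0 => u _; rewrite invr_ge0.
have DM m : (0 < m <= M ^ r)%N -> (size (divisors m))%:R <= C1 * X ^+ r.
  case/andP=> m0 mM; apply: le_trans (h1 m m0) _; rewrite ler_wpM2l ?(ltW C10) //.
  have -> : X ^+ r = ((3 * Q) ^+ r) `^ eta.
    rewrite -powR_mulrn // -powR_mulrn -?powRrM; last lra.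
    by rewrite [eta * _]mulrC.
  rewrite (@ge0_ler_powR _ eta) ?nnegrE ?(ltW eta0) ?ler0n ?exprn_ge0 //; first lra.
  apply: (@le_trans _ _ (M ^ r)%:R); first by rewrite ler_nat.
  by rewrite natrX lerXn2r ?nnegrE ?ler0n //; lra.
have CX0 : 0 <= C1 * X ^+ r by rewrite mulr_ge0 ?exprn_ge0 ?(ltW C10).
split=> [|s us].
  apply: le_trans (diagonal_sum_le DM) _.
  apply: (@le_trans _ _ ((C1 * X ^+ r) ^+ r * (C2 * X) ^+ r)).
    by rewrite ler_wpM2l ?exprn_ge0 // lerXn2r ?nnegrE ?mulr_ge0 ?(ltW C20).
  have -> : (C1 * X ^+ r) ^+ r * (C2 * X) ^+ r = (C1 * C2) ^+ r * X ^+ (r * r + r).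
    by rewrite !exprMn exprD -exprM; ring.
  rewrite -[leRHS]mulrA ler_pM ?exprn_ge0 ?mulr_ge0 ?(ltW C10) ?(ltW C20) //.
    by rewrite lerDl mulr_ge0 ?exprn_ge0 ?(ltW C10) ?(ltW C20).
  by apply: XE; rewrite -mulnn; lia.
apply: le_trans (sum_offdiagonal_sum_le us CX0 DM) _.
apply: (@le_trans _ _ (C1 * X ^+ r * (C2 * X) ^+ (2 * r))).
  by rewrite ler_wpM2l // lerXn2r ?nnegrE ?mulr_ge0 ?(ltW C20).
have -> : C1 * X ^+ r * (C2 * X) ^+ (2 * r) = C1 * C2 ^+ (2 * r) * X ^+ (r + 2 * r).
  by rewrite !exprMn exprD; ring.
rewrite -[leRHS]mulrA ler_pM ?mulr_ge0 ?exprn_ge0 ?mulr_ge0 ?(ltW C10) ?(ltW C20) //.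
  by rewrite lerDr exprn_ge0 ?mulr_ge0 ?(ltW C10) ?(ltW C20).
by apply: XE; rewrite -mulnn; lia.
Qed.

(** Residues beyond q / 2 are written as q - u, which brings out chi(-1); the midpoint goes to the
    first sum only. Padding with zeros up to [M] gives all moduli a common range of summation. *)
Lemma gauss_sum_split q M L N chi : (1 < q)%N -> (q <= M)%N -> dirichlet_character q chi ->
  \sum_(L.+1 <= n < (L + N).+1) gauss_sum q chi n%:Z =
  \sum_(u < M) chi u%:Z * (if (0 < u)%N && (2 * u <= q)%N then exp_sum q L N u%:Z else 0)
  + chi (- 1) *
    \sum_(u < M) chi u%:Z * (if (0 < u)%N && (2 * u < q)%N then exp_sum q L N (- u%:Z) else 0)
  :> R[i].
Proof.
move=> q1 qM dchi; have q0 : (0 < q)%N by exact: ltnW.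
have [per mul supp] := dchi.
pose F (x : nat) := chi x%:Z * exp_sum q L N x%:Z.
have widen (P : pred nat) (G : nat -> R[i]) :
    \sum_(u < M) chi u%:Z * (if (0 < u)%N && (P u && (u < q)%N) then G u else 0) =
    \sum_(1 <= u < q | P u) chi u%:Z * G u.
  rewrite (big_nat_widenl 1 0) // (big_nat_widen 0 q M) // big_mkord [RHS]big_mkcond /=.
  apply: eq_bigr => u _; rewrite andbA [(0 < u)%N && _]andbC.
  by case: ifP; rewrite ?mulr0.
have -> : \sum_(L.+1 <= n < (L + N).+1) gauss_sum q chi n%:Z = \sum_(1 <= x < q) F x.
  rewrite /gauss_sum exchange_big /=.
  have F0 : F 0%N = 0.
    rewrite /F (_ : chi 0 = 0) ?mul0r //; apply/eqP/negPn; rewrite supp.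
    by rewrite /coprimez gcd0z; case: q q1 {q0 qM dchi per supp F widen} => [|[]].
  transitivity (\sum_(0 <= x < q) F x); last by rewrite (big_ltn q0) F0 add0r.
  rewrite big_mkord big_mkcond /=; apply: eq_bigr => x _.
  rewrite /F /exp_sum -mulr_sumr; case: ifPn => // ncop.
  by rewrite (_ : chi x = 0) ?mul0r //; apply/eqP/negPn; rewrite supp.
rewrite (bigID (fun x => 2 * x <= q)%N) /=; congr (_ + _).
  rewrite -(widen (fun u => 2 * u <= q)%N (fun u => exp_sum q L N u%:Z)).
  apply: eq_bigr => u _; suff -> : [&& 0 < u, 2 * u <= q & u < q]%N = (0 < u)%N && (2 * u <= q)%N by [].
  by apply/idP/idP; lia.
(* Reversal sends u to 1 + q - (u + 1) = q - u. *)
rewrite big_nat_rev /=.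
transitivity (chi (- 1) * \sum_(1 <= u < q | (2 * u < q)%N) chi u%:Z * exp_sum q L N (- u%:Z)).
  rewrite mulr_sumr big_nat_cond [RHS]big_nat_cond; apply: eq_big => u.
    by apply/idP/idP; lia.
  case/andP=> /andP[u1 uq] _; rewrite /F mulrA; congr (_ * _).
    rewrite -mul; apply: per.
    have -> : (1 + q - u.+1)%N%:Z = q%:Z + -1 * u%:Z by lia.
    by rewrite modzDl.
  rewrite /exp_sum; apply: eq_bigr => n _; rewrite !eq_exp_natM; congr (_ ^+ _).
  have -> : (1 + q - u.+1)%N%:Z = q%:Z + - u%:Z by lia.
  by rewrite eq_expD eq_expq // mul1r.
congr (_ * _).
rewrite -(widen (fun u => 2 * u < q)%N (fun u => exp_sum q L N (- u%:Z))).
apply: eq_bigr => u _; suff -> : [&& 0 < u, 2 * u < q & u < q]%N = (0 < u)%N && (2 * u < q)%N by [].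
by apply/idP/idP; lia.
Qed.
End MomentBounds.

(** * The exceptional moduli *)

Section Assembly.
Context {R : realType}.
Local Notation normc := (@Normc.normc R).

Lemma powR_expn (x a : R) (n m : nat) : 0 <= x -> a * n%:R = m%:R -> (x `^ a) ^+ n = x ^+ m.
Proof. by move=> x0 E; rewrite -powR_mulrn ?powR_ge0 // -powRrM E powR_mulrn. Qed.

(** As C >= 1, the constant is at most C^n and can be kept when the root is taken. *)
Lemma ler_expn_root (x y C : R) n : (0 < n)%N -> 1 <= C -> 0 <= x -> 0 <= y ->
  x ^+ n <= C * y ^+ n -> x <= C * y.
Proof.
move=> n0 C1 x0 y0 le; have C0 : 0 <= C by apply: le_trans C1.
rewrite -(@ler_pXn2r _ n) ?nnegrE ?mulr_ge0 //; apply: le_trans le _.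
by rewrite exprMn ler_wpM2r ?exprn_ge0 // ler_eXnr.
Qed.

Lemma weighted_sum_holder (I : finType) (w U : I -> R) r (C Y : R) : (1 < r)%N ->
  (forall i, 0 <= w i) -> (forall i, 0 <= U i) -> 1 <= C -> 0 <= Y ->
  \sum_i U i ^+ (2 * r) <= C * Y ^+ (2 * r) ->
  \sum_i w i * U i <= C * ((\sum_i w i) `^ (1 - r%:R^-1) *
     ((\sum_i w i ^+ 2) `^ 2^-1) `^ r%:R^-1 * Y).
Proof.
move=> r1 w0 U0 C1 Y0 hU; have r0 : (0 < r)%N by exact: ltnW.
have rR : r%:R != 0 :> R by rewrite pnatr_eq0 -lt0n.
have A0 : 0 <= \sum_i w i by apply: sumr_ge0.
have B0 : 0 <= \sum_i w i ^+ 2 by apply: sumr_ge0 => i _; rewrite sqr_ge0.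
apply: (@ler_expn_root _ _ _ (2 * r)) => //; first by rewrite muln_gt0.
- by apply: sumr_ge0 => i _; rewrite mulr_ge0.
- by rewrite !mulr_ge0 ?powR_ge0.
apply: le_trans (holder_even_moment r0 w0 U0) _.
(* After raising to the power 2r, the exponents 1 - 1/r and 1/(2r) become 2 (r - 1) and 1, as in
   [holder_even_moment]. *)
rewrite -powRrM [in leRHS]exprMn [in leRHS]exprMn.
rewrite (@powR_expn _ _ (2 * r) (2 * r.-1)) //; last first.
  by rewrite !natrM -subn1 natrB //; field.
rewrite (@powR_expn _ _ (2 * r) 1) // ?expr1; last by rewrite natrM; field.
by rewrite [leRHS]mulrCA ler_wpM2l // mulr_ge0 ?exprn_ge0.
Qed.

(** This is a^(2r) + b^(2r) <= (a + b)^(2r), where b is chosen so that b^(2r) = N^r q^(r+1). *)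
Lemma moment_size_le (q N r : nat) : (0 < r)%N ->
  q%:R ^+ (2 * r) + N%:R ^+ r * q%:R ^+ r.+1 <=
  (q%:R + N%:R `^ 2^-1 * q%:R `^ (2^-1 + (2 * r%:R)^-1)) ^+ (2 * r) :> R.
Proof.
move=> r0; have rR : r%:R != 0 :> R by rewrite pnatr_eq0 -lt0n.
set b := _ `^ _ * _; have b0 : 0 <= b by rewrite mulr_ge0 ?powR_ge0.
have -> : N%:R ^+ r * q%:R ^+ r.+1 = b ^+ (2 * r).
  rewrite exprMn (@powR_expn _ _ (2 * r) r) //; last by rewrite natrM; field.
  rewrite (@powR_expn _ _ (2 * r) r.+1) //.
  by rewrite natrM -natr1; field.
have : (0 < 2 * r)%N by rewrite muln_gt0.
case: (2 * r)%N => // n _; rewrite exprS [b ^+ _]exprS exprS mulrDl.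
by apply: lerD; apply: ler_wpM2l => //; rewrite lerXn2r ?nnegrE ?addr_ge0 // ?lerDl ?lerDr.
Qed.

Lemma markov_card (s : seq nat) (g : nat -> R) (t B : R) : uniq s -> (forall q, 0 <= g q) ->
  \sum_(q <- s) g q <= B ->
  (#|` [fset q in [seq q <- s | t < g q]]|%fset)%:R * t <= B.
Proof.
move=> us g0; apply: le_trans; rewrite card_fseq undup_id ?filter_uniq //.
rewrite (bigID (fun q => t < g q)) /= -[leLHS]addr0 lerD ?sumr_ge0 //.
apply: (@le_trans _ _ (\sum_(q <- s | t < g q) t)).
  by rewrite big_const_seq -size_filter iter_addr_0 mulr_natl.
by apply: ler_sum => q /ltW.
Qed.

Lemma character_moment_le (q M r L N : nat) (eps delta Q C : R) (S : {fset (int -> R[i])})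
    (a : nat -> R[i]) :
  (0 < r)%N -> 0 < eps -> 0 < delta -> 1 <= Q -> Q <= q%:R <= 2 * Q -> 0 <= C ->
  {in S, forall chi, dirichlet_character q chi} ->
  (forall u, normc (a u) <= N%:R) -> (forall u, normc (a u) <= q%:R * u%:R^-1) ->
  diagonal_sum M r <= C * Q `^ delta ->
  offdiagonal_sum q M r <= Q `^ (2 * r%:R * eps - 1) ->
  \sum_(chi <- S) normc (\sum_(u < M) chi u%:Z * a u) ^+ (2 * r) <=
  (C + 2) * ((q%:R + N%:R `^ 2^-1 * q%:R `^ (2^-1 + (2 * r%:R)^-1)) *
     q%:R `^ (eps + delta)) ^+ (2 * r).
Proof.
move=> r0 e0 d0 Q1 /andP[Qq qQ] C0 dS aN aq hD hO.
have q1 : 1 <= q%:R :> R by apply: le_trans Qq.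
have q0 : (0 < q)%N by rewrite -(ltr0n R) (lt_le_trans ltr01).
have qR : 0 < q%:R :> R by rewrite ltr0n.
have Qgt : 0 < Q by apply: lt_le_trans Q1.
apply: le_trans (dirichlet_moment_le M r q0 dS aN aq) _.
rewrite [in leRHS]exprMn -(powR_mulrn _ (powR_ge0 _ _)) -powRrM; set z := q%:R `^ ((eps + delta) * _).
have r1 : 1 <= r%:R :> R by rewrite ler1n.
(* Since 2 r >= 1, [z] absorbs both the diagonal loss Q^delta and the off-diagonal loss; these
   contribute C and 2 to the constant. *)
have z1 : q%:R `^ delta <= z by rewrite /z ler_powR // natrM; nra.
have z2 : q%:R `^ (2 * r%:R * eps) <= z by rewrite /z ler_powR // natrM; nra.
have z0 : 0 <= z by rewrite powR_ge0.
have D1 : diagonal_sum M r <= C * z.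
  apply: le_trans hD _; apply: ler_wpM2l => //; apply: le_trans z1.
  by rewrite (@ge0_ler_powR _ delta) ?nnegrE ?(ltW d0) ?(ltW Qgt) ?(ltW qR).
(* The factor q from Bessel cancels the -1 in the exponent of the threshold, at the cost of q <= 2
   Q. *)
have O1 : q%:R * offdiagonal_sum q M r <= 2 * z.
  apply: (@le_trans _ _ (2 * Q * Q `^ (2 * r%:R * eps - 1))).
    apply: (@le_trans _ _ (q%:R * Q `^ (2 * r%:R * eps - 1))).
      by rewrite ler_wpM2l // ltW.
    by rewrite ler_wpM2r ?powR_ge0.
  rewrite -mulrA mulr_powRB1 ?(ltW Qgt) //; last by rewrite !mulr_gt0 // ltr0n.
  rewrite ler_wpM2l //; apply: le_trans z2.
  have e1 : 0 <= 2 * r%:R * eps by rewrite !mulr_ge0 // ltW.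
  by rewrite (@ge0_ler_powR _ (2 * r%:R * eps)) ?nnegrE ?(ltW Qgt) ?(ltW qR).
apply: (@le_trans _ _ ((C + 2) * (q%:R ^+ (2 * r) + N%:R ^+ r * q%:R ^+ r.+1) * z)); last first.
  rewrite -mulrA ler_wpM2l ?addr_ge0 // ler_wpM2r //.
  exact: moment_size_le.
set X := q%:R ^+ (2 * r); have X0 : 0 <= X by rewrite exprn_ge0.
have -> : q%:R * ((N%:R * q%:R) ^+ r * diagonal_sum M r + X * offdiagonal_sum q M r) =
  N%:R ^+ r * q%:R ^+ r.+1 * diagonal_sum M r + X * (q%:R * offdiagonal_sum q M r).
  by rewrite exprMn exprS; ring.
set V := N%:R ^+ r * q%:R ^+ r.+1; have V0 : 0 <= V by rewrite mulr_ge0 ?exprn_ge0.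
have := ler_wpM2l V0 D1; have := ler_wpM2l X0 O1.
have Xz : 0 <= X * z by rewrite mulr_ge0.
have Vz : 0 <= V * z by rewrite mulr_ge0.
have XCz : 0 <= C * (X * z) by rewrite mulr_ge0.
move=> h1 h2; apply: le_trans (lerD h2 h1) _.
by move: Xz Vz XCz; clear; nra.
Qed.

Lemma weight_normE q omega : (0 < q)%N ->
  weight_norm q omega 1 = \sum_(chi <- fset_set (primitive_characters q)) normc (omega chi) /\
  weight_norm q omega 2 =
    (\sum_(chi <- fset_set (primitive_characters q)) normc (omega chi) ^+ 2) `^ 2^-1.
Proof.
move=> q0; rewrite /weight_norm; have fin := @finite_primitive_characters R q q0.
split; rewrite fsbig_finite //=; last first.
  by congr (_ `^ _); apply: eq_bigr => chi _; rewrite powR_mulrn // normc_ge0.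
rewrite invr1 powRr1; last by apply: sumr_ge0 => chi _; rewrite powR_ge0.
by apply: eq_bigr => chi _; rewrite powRr1 // normc_ge0.
Qed.

(** Serves both halves of the residues, which differ only in the coefficients [a]. *)
Lemma weighted_half_le (q M r L N : nat) (eps delta Q C : R) (omega : (int -> R[i]) -> R[i])
    (a : nat -> R[i]) :
  (1 < r)%N -> 0 < eps -> 0 < delta -> 1 <= Q -> Q <= q%:R <= 2 * Q -> 0 <= C ->
  (forall u, normc (a u) <= N%:R) -> (forall u, normc (a u) <= q%:R * u%:R^-1) ->
  diagonal_sum M r <= C * Q `^ delta ->
  offdiagonal_sum q M r <= Q `^ (2 * r%:R * eps - 1) ->
  \sum_(chi <- fset_set (primitive_characters q))
    normc (omega chi) * normc (\sum_(u < M) chi u%:Z * a u) <=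
  (C + 2) * (weight_norm q omega 1 `^ (1 - r%:R^-1) * weight_norm q omega 2 `^ (r%:R^-1) *
    (q%:R + N%:R `^ (2^-1) * q%:R `^ (2^-1 + (2 * r%:R)^-1)) * q%:R `^ (eps + delta)).
Proof.
move=> r1 e0 d0 Q1 qQ C0 aN aq hD hO; have r0 : (0 < r)%N by exact: ltnW.
have q0 : (0 < q)%N.
  by case/andP: qQ => Qq _; rewrite -(ltr0n R) (lt_le_trans ltr01) // (le_trans Q1).
have [-> ->] := weight_normE omega q0.
have fin := @finite_primitive_characters R q q0.
set S := fset_set _; have dS : {in S, forall chi, dirichlet_character q chi}.
  by move=> chi; rewrite in_fset_set // inE => -[].
have mom := character_moment_le L r0 e0 d0 Q1 qQ C0 dS aN aq hD hO.
rewrite -mulrA !big_seq_fsetE /=; rewrite big_seq_fsetE /= in mom.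
apply: weighted_sum_holder => //.
- by move=> chi; exact: normc_ge0.
- by move=> chi; exact: normc_ge0.
- by rewrite ler_wpDl // ler1n.
Qed.

Lemma normc_weighted_sum_le (q M L N : nat) (omega : (int -> R[i]) -> R[i]) :
  (1 < q)%N -> (q <= M)%N -> exists ap am : nat -> R[i],
  [/\ forall u, normc (ap u) <= N%:R, forall u, normc (am u) <= N%:R,
      forall u, normc (ap u) <= q%:R * u%:R^-1, forall u, normc (am u) <= q%:R * u%:R^-1
    & normc (weighted_sum q omega L N) <=
      \sum_(chi <- fset_set (primitive_characters q))
         normc (omega chi) * normc (\sum_(u < M) chi u%:Z * ap u) +
      \sum_(chi <- fset_set (primitive_characters q))
         normc (omega chi) * normc (\sum_(u < M) chi u%:Z * am u)].
Proof.
move=> q1 qM; have q0 : (0 < q)%N by exact: ltnW.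
exists (fun u => if (0 < u)%N && (2 * u <= q)%N then exp_sum q L N u%:Z else 0).
exists (fun u => if (0 < u)%N && (2 * u < q)%N then exp_sum q L N (- u%:Z) else 0).
have div0 u : 0 <= q%:R * u%:R^-1 :> R by rewrite mulr_ge0 ?invr_ge0.
split=> [u|u|u|u|].
- by case: ifP => _; [exact: normc_exp_sum_le | rewrite Normc.normc0].
- by case: ifP => _; [exact: normc_exp_sum_le | rewrite Normc.normc0].
- case: ifP => [/andP[u0 uq]|_]; last by rewrite Normc.normc0.
  by case: (@normc_exp_sum_le_div R q L N u u0 uq).
- case: ifP => [/andP[u0 /ltnW uq]|_]; last by rewrite Normc.normc0.
  by case: (@normc_exp_sum_le_div R q L N u u0 uq).
have fin := @finite_primitive_characters R q q0.
rewrite /weighted_sum fsbig_finite //=; apply: le_trans (normc_sum _ _ _) _.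
rewrite -big_split /= big_seq [leRHS]big_seq; apply: ler_sum => chi.
rewrite in_fset_set // inE => -[dchi _].
rewrite -mulr_sumr Normc.normcM -mulrDr; apply: ler_wpM2l; first exact: normc_ge0.
rewrite (gauss_sum_split L N q1 qM dchi); apply: le_trans (le_normcD _ _) _.
rewrite lerD2l Normc.normcM (normc_dirichlet_character q0 dchi) ?mul1r //.
by rewrite /coprimez gcdNz gcd1z.
Qed.

End Assembly.

Theorem theorem2p4 (R : realType) (eps : R) (r : nat) (heps : 0 < eps)
    (hr : (2 <= r)%N) :
  forall delta : R, 0 < delta ->
  exists Q0 C : R, [/\ 1 <= Q0, 0 < C
    & forall Q : R, Q0 <= Q ->
      exists E : {fset nat},
        (#|` E|)%:R <= Q `^ (1 - 2 * r%:R * eps + delta) /\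
        forall q : nat, Q <= q%:R <= 2 * Q -> q \notin E ->
        forall L N : nat, (L + N <= q.-1)%N ->
        forall omega : (int -> R[i]) -> R[i],
          Normc.normc (weighted_sum q omega L N) <=
          C * (weight_norm q omega 1 `^ (1 - r%:R^-1) *
               weight_norm q omega 2 `^ (r%:R^-1) *
               (q%:R + N%:R `^ (2^-1) * q%:R `^ (2^-1 + (2 * r%:R)^-1)) *
               q%:R `^ (eps + delta))].
Proof.
move=> delta d0; have r0 : (0 < r)%N by exact: ltnW.
have h0 : 0 < delta / 2 by rewrite divr_gt0.
have [C C0 hC] := moment_sums_le r0 h0.
(* The entry 2 ensures q > 1 and the other one C <= Q^(delta/2). Each half of the residues
   contributes C + 2. *)
exists (Num.max 2 (C `^ (delta / 2)^-1)), (2 * (C + 2)); split.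
- by rewrite le_max ler1n.
- by rewrite mulr_gt0 // addr_gt0.
move=> Q; rewrite ge_max => /andP[Q2 QC].
have Q1 : 1 <= Q by apply: le_trans Q2; rewrite ler1n.
have Qgt : 0 < Q by apply: lt_le_trans Q1.
have CQ : C <= Q `^ (delta / 2).
  have /esym E : (C `^ (delta / 2)^-1) `^ (delta / 2) = C.
    by rewrite -powRrM mulVf ?powRr1 ?(ltW C0) ?lt0r_neq0.
  rewrite [leLHS]E.
  by rewrite (@ge0_ler_powR _ (delta / 2)) ?nnegrE ?powR_ge0 ?(ltW h0) ?(ltW Qgt).
have QQ : Q `^ (delta / 2) * Q `^ (delta / 2) = Q `^ delta.
  rewrite -powRD; last by rewrite (gt_eqF Qgt) implybT.
  by congr (_ `^ _); field.
(* One range for all moduli, exceeding every q <= 2 Q, so that the off-diagonal sums can be averaged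
   over q. *)
pose M := (Num.truncn (2 * Q)).+1.
have MQ : M%:R <= 3 * Q.
  have : (Num.truncn (2 * Q))%:R <= 2 * Q by rewrite truncn_le; lra.
  by rewrite /M -natr1; lra.
have [diag off] := hC Q M Q1 isT MQ.
(* The largest power of Q that the target moment tolerates. By Markov at most C Q^(delta/2) / t <=
   Q^(1 - 2 r eps + delta) moduli exceed it. *)
pose t := Q `^ (2 * r%:R * eps - 1).
exists [fset q in [seq q <- iota 0 M | t < offdiagonal_sum q M r]]%fset; split.
  have off0 q : (0 : R) <= offdiagonal_sum q M r.
    by apply: sumr_ge0 => f _; apply: sumr_ge0 => g _; rewrite mulr_ge0 ?invr_ge0.
  have t0 : 0 < t by rewrite powR_gt0.
  have := markov_card t (iota_uniq 0 M) off0 (off _ (iota_uniq 0 M)).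
  rewrite -ler_pdivlMr // => /le_trans; apply.
  rewrite ler_pdivrMr // -powRD; last by rewrite (gt_eqF Qgt) implybT.
  have -> : 1 - 2 * r%:R * eps + delta + (2 * r%:R * eps - 1) = delta by ring.
  by rewrite -QQ ler_wpM2r ?powR_ge0.
move=> q qQ qE L N _ omega.
have [Qq q2Q] := andP qQ.
have qM : (q < M)%N.
  by rewrite -(ltr_nat R); apply: le_lt_trans q2Q _; exact: truncnS_gt.
have q1 : (1 < q)%N by rewrite -(ler_nat R); apply: le_trans Qq.
have hO : offdiagonal_sum q M r <= t.
  rewrite leNgt; apply: contra qE => tq.
  by rewrite !inE mem_filter tq mem_iota qM.
have hD : diagonal_sum M r <= C * Q `^ delta.
  apply: le_trans diag _; rewrite ler_wpM2l ?(ltW C0) // ler_powR //.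
  by rewrite ler_pdivrMr // ler_peMr ?(ltW d0) // ler1n.
have [ap [am [apN amN apq amq le]]] := normc_weighted_sum_le L N omega q1 (ltnW qM).
apply: le_trans le _.
have hp := weighted_half_le L omega hr heps d0 Q1 qQ (ltW C0) apN apq hD hO.
have hm := weighted_half_le L omega hr heps d0 Q1 qQ (ltW C0) amN amq hD hO.
by apply: le_trans (lerD hp hm) _; rewrite -[leRHS]mulrA [leRHS]mulr_natl mulr2n.
Qed.
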